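(* Let $p\ge 1$ and let $\Gamma:\Omega\to\mathcal{K}_c(\mathbb{R}^p)$ be a compact convex random set on a probability space $(\Omega,\mathcal{A},\mathbb{P})$. Then for every $K\in\mathcal{K}_c(\mathbb{R}^p)$, $$D_{CT}(K;\Gamma)=\min\Big\{\inf_{u\in\mathbb{S}^{p-1}}\mathbb{P}\big(s_\Gamma(u)\le s_K(u)\big),\ \inf_{u\in\mathbb{S}^{p-1}}\mathbb{P}\big(s_\Gamma(u)\ge s_K(u)\big)\Big\}.$$
   Context: $\mathcal{K}_c(\mathbb{R}^p)$ denotes the set of non-empty compact convex subsets of $\mathbb{R}^p$, and $\mathbb{S}^{p-1}=\{x\in\mathbb{R}^p:\|x\|=1\}$ the Euclidean unit sphere. The support function of $K\in\mathcal{K}_c(\mathbb{R}^p)$ is $s_K:\mathbb{S}^{p-1}\to\mathbb{R}$, $s_K(u)=\sup_{k\in K}\langle k,u\rangle$. A map $\Gamma:\Omega\to\mathcal{K}_c(\mathbb{R}^p)$ on a probability space $(\Omega,\mathcal{A},\mathbb{P})$ is a compact convex random set if $\{\omega\in\Omega:\Gamma(\omega)\cap K\ne\emptyset\}\in\mathcal{A}$ for all $K\in\mathcal{K}_c(\mathbb{R}^p)$; equivalently, it is Borel measurable with respect to the Hausdorff metric. Then $s_\Gamma(u)$, $\omega\mapsto s_{\Gamma(\omega)}(u)$, is a real random variable for each $u\in\mathbb{S}^{p-1}$. For $u\in\mathbb{S}^{p-1}$, $t\in\mathbb{R}$, define the halfspaces $S^-_{u,t}=\{K\in\mathcal{K}_c(\mathbb{R}^p):s_K(u)\le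 t\}$ and $S^+_{u,t}=\{K\in\mathcal{K}_c(\mathbb{R}^p):s_K(u)\ge t\}$. The Tukey depth of $K\in\mathcal{K}_c(\mathbb{R}^p)$ with respect to $\Gamma$ is $$D_{CT}(K;\Gamma)=\min\Big\{\inf_{u\in\mathbb{S}^{p-1},\,t\in\mathbb{R}:\ K\in S^-_{u,t}}\mathbb{P}(\Gamma\in S^-_{u,t}),\ \inf_{u\in\mathbb{S}^{p-1},\,t\in\mathbb{R}:\ K\in S^+_{u,t}}\mathbb{P}(\Gamma\in S^+_{u,t})\Big\}.$$ *)

(* Defs.v *)
From HB Require Import structures.
From mathcomp Require Import all_boot all_order all_algebra.
From mathcomp Require Import all_classical all_reals all_analysis.

Set Implicit Arguments.
Unset Strict Implicit.
Unset Printing Implicit Defensive.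

Import Order.TTheory GRing.Theory Num.Theory.
Import numFieldTopology.Exports numFieldNormedType.Exports.

Local Open Scope classical_set_scope.
Local Open Scope ring_scope.

Definition dotp (R : realType) (p : nat) (x y : 'rV[R]_p) : R :=
  \sum_(i < p) x ord0 i * y ord0 i.

(* The norm that the library puts on matrices is the sup norm, hence a separate
   Euclidean norm; the topology (thus [compact]) is the same for both. *)
Definition enorm (R : realType) (p : nat) (x : 'rV[R]_p) : R :=
  Num.sqrt (dotp x x).

Definition sphere (R : realType) (p : nat) : set 'rV[R]_p :=
  [set u | enorm u = 1].

Record Kc (R : realType) (p : nat) := MkKc {
  Kc_set :> set 'rV[R]_p;
  Kc_nonempty : Kc_set !=set0;
  Kc_compact : compact Kc_set;
  Kc_convex : convex_set Kc_set
}.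

(* [sup] is the real-valued supremum, with value 0 on sets that are empty or
   unbounded above; neither case occurs here since K is nonempty and compact. *)
Definition supp_fun (R : realType) (p : nat) (K : Kc R p) (u : 'rV[R]_p) : R :=
  sup [set dotp k u | k in (K : set 'rV[R]_p)].

Definition random_set (d : measure_display) (T : measurableType d)
    (R : realType) (p : nat) (Gamma : T -> Kc R p) : Prop :=
  forall K : Kc R p, measurable [set w | (Gamma w `&` K) !=set0].

Definition Sminus (R : realType) (p : nat) (u : 'rV[R]_p) (t : R) :
    set (Kc R p) :=
  [set K | supp_fun K u <= t].

Definition Splus (R : realType) (p : nat) (u : 'rV[R]_p) (t : R) :
    set (Kc R p) :=
  [set K | t <= supp_fun K u].

(* Probabilities are extended reals in the library, hence so is the depth. *)
Definition tukey_depth (d : measure_display) (T : measurableType d)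
    (R : realType) (P : probability T R) (p : nat) (K : Kc R p)
    (Gamma : T -> Kc R p) : \bar R :=
  Order.min
    (ereal_inf [set P (Gamma @^-1` Sminus ut.1 ut.2) | ut in
       [set ut : 'rV[R]_p * R | sphere ut.1 /\ Sminus ut.1 ut.2 K]])
    (ereal_inf [set P (Gamma @^-1` Splus ut.1 ut.2) | ut in
       [set ut : 'rV[R]_p * R | sphere ut.1 /\ Splus ut.1 ut.2 K]]).

(* Main.v *)
Require Import Defs.
From HB Require Import structures.
From mathcomp Require Import all_boot all_order all_algebra.
From mathcomp Require Import all_classical all_reals all_analysis.
From mathcomp Require Import measurable_realfun.

Import Order.TTheory GRing.Theory Num.Theory.
Import numFieldTopology.Exports numFieldNormedType.Exports.

Local Open Scope classical_set_scope.
Local Open Scope ring_scope.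

(** Fix a direction [u]. Among the halfspaces [Sminus u t] that contain [K],
    the one at level [t = supp_fun K u] is contained in all the others, and
    likewise for [Splus u t]. By monotonicity of the probability, each infimum
    over pairs [(u, t)] is therefore an infimum over [u] alone
    ([ereal_inf_optimal_param]).

    Monotonicity only holds between measurable events, so the work lies in
    showing that the support function of [Gamma] in direction [u] is a random
    variable when only hitting events of compact convex sets are known to be
    measurable. Since the supremum in [supp_fun] is attained, the event
    [t <= supp_fun (Gamma w) u] says that [Gamma w] hits the closed halfspace
    of the [x] with [t <= dotp x u]; this halfspace is a countable union of
    compact convex sets ([measurable_ge_supp_fun]), and the rays bounded below
    generate the Borel sets of the line. *)

Lemma dotp_continuous (R : realType) (p : nat) (u : 'rV[R]_p) :
  continuous (fun x : 'rV[R]_p => dotp x u).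
Proof.
apply: continuous_big => [|i _ x]; first exact: add_continuous.
apply: (@cvgMr_tmp R _ (nbhs x) _ (fun y : 'rV[R]_p => y ord0 i)).
exact: coord_continuous.
Qed.

Lemma dotp_linear (R : realType) (p : nat) (u x y : 'rV[R]_p) (a b : R) :
  dotp (a *: x + b *: y) u = a * dotp x u + b * dotp y u.
Proof.
rewrite /dotp !mulr_sumr -big_split; apply: eq_bigr => i _ /=.
by rewrite !mxE mulrDl !mulrA.
Qed.

(** The supremum defining the support function of a nonempty compact set is
    attained: a continuous function has a maximum on it. Hence a level is
    reached by the support function exactly when it is reached by a point. *)
Lemma ge_supp_fun (R : realType) (p : nat) (K : Kc R p) (u : 'rV[R]_p) (t : R) :
  t <= supp_fun K u <-> exists2 k, Kc_set K k & t <= dotp k u.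
Proof.
have [c cK cmax] : exists2 c, c \in Kc_set K &
    forall k, k \in Kc_set K -> dotp k u <= dotp c u.
  apply: EVT_max_rV; [exact: Kc_nonempty|exact: Kc_compact|].
  by apply: continuous_subspaceT; exact: dotp_continuous.
have ubc : ubound [set dotp k u | k in Kc_set K] (dotp c u).
  by move=> _ [k Kk <-]; apply: cmax; rewrite inE.
split=> [tK|[k Kk tk]].
- exists c; first by rewrite inE in cK.
  apply: le_trans tK _; apply: ge_sup ubc.
  by have [k Kk] := Kc_nonempty K; exists (dotp k u), k.
- apply: le_trans tk _; apply: ub_le_sup; last by exists k.
  by exists (dotp c u).
Qed.

(** The ball is that of the library norm (the sup norm on coordinates): any norm
    does, as only compactness, convexity and exhaustion of the space matter. *)
Definition slice {R : realType} {p : nat} (u : 'rV[R]_p) (t r : R) :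
    set 'rV[R]_p :=
  [set x | `|x| <= r] `&` [set x | t <= dotp x u].

Lemma slice_compact (R : realType) (p : nat) (u : 'rV[R]_p) (t r : R) :
  compact (slice u t r).
Proof.
apply: bounded_closed_compact.
- exists r; split; first exact: num_real.
  by move=> M rM x [xr _]; exact: le_trans xr (ltW rM).
- apply: closedI.
  + apply: (@closed_comp _ _ (fun x : 'rV[R]_p => `|x|) [set y | y <= r]).
      by move=> x _; exact: norm_continuous.
    exact: closed_le.
  + apply: (@closed_comp _ _ (fun x => dotp x u) [set y | t <= y]).
      by move=> x _; exact: dotp_continuous.
    exact: closed_ge.
Qed.

Lemma slice_convex (R : realType) (p : nat) (u : 'rV[R]_p) (t r : R) :
  convex_set (slice u t r).
Proof.
move=> x y l; rewrite !inE => -[xr tx] [yr ty].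
have l0 : 0 <= l%:num by [].
have l1 : 0 <= 1 - l%:num by rewrite subr_ge0.
have avg s : s = l%:num * s + (1 - l%:num) * s by rewrite -mulrDl subrKC mul1r.
rewrite -[conv l x y]/(l%:num *: x + (1 - l%:num) *: y).
split=> /=.
- rewrite (avg r); apply: le_trans (ler_normD _ _) _.
  by rewrite !normrZ !ger0_norm// lerD// ler_wpM2l.
- by rewrite dotp_linear (avg t) lerD// ler_wpM2l.
Qed.

(** The hitting condition in [random_set] ranges over nonempty sets only; an
    empty set is hit by no value of [Gamma]. *)
Lemma measurable_hit (R : realType) (p : nat) (d : measure_display)
    (T : measurableType d) (Gamma : T -> Kc R p) (C : set 'rV[R]_p) :
  random_set Gamma -> compact C -> convex_set C ->
  measurable [set w | (Gamma w `&` C) !=set0].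
Proof.
move=> mGamma cC xC; have [->|/set0P C0] := eqVneq C set0.
  rewrite (_ : [set w | _] = set0); first exact: measurable0.
  by apply/seteqP; split=> // w [x []].
exact: (mGamma (MkKc C0 cC xC)).
Qed.

(** A closed halfspace is not compact, but it is the union of its slices by
    balls of integer radius, so that meeting it is a countable union of hitting
    events. *)
Lemma measurable_ge_supp_fun (R : realType) (p : nat) (d : measure_display)
    (T : measurableType d) (Gamma : T -> Kc R p) (u : 'rV[R]_p) (t : R) :
  random_set Gamma -> measurable [set w | t <= supp_fun (Gamma w) u].
Proof.
move=> mGamma.
rewrite (_ : [set w | _] =
    \bigcup_n [set w | (Gamma w `&` slice u t n%:R) !=set0]).
  apply: bigcupT_measurable => n; apply: measurable_hit => //.
  - exact: slice_compact.
  - exact: slice_convex.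
apply/seteqP; split=> w /=.
- move/ge_supp_fun => [x Gx tx]; exists (Num.truncn `|x|).+1 => //.
  exists x; split=> //; split=> //=.
  by apply/ltW/truncnS_gt.
- by move=> [n _ [x [Gx [_ tx]]]]; apply/ge_supp_fun; exists x.
Qed.

Lemma measurable_supp_fun (R : realType) (p : nat) (d : measure_display)
    (T : measurableType d) (Gamma : T -> Kc R p) (u : 'rV[R]_p) :
  random_set Gamma -> measurable_fun setT (fun w => supp_fun (Gamma w) u).
Proof.
move=> mGamma mT; apply: (measurability _ (RGenCInfty.measurableE R)) => //.
move=> _ [_ [t ->] <-]; rewrite setTI set_itvcy.
exact: measurable_ge_supp_fun.
Qed.

Lemma measurable_le_supp_fun (R : realType) (p : nat) (d : measure_display)
    (T : measurableType d) (Gamma : T -> Kc R p) (u : 'rV[R]_p) (t : R) :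
  random_set Gamma -> measurable [set w | supp_fun (Gamma w) u <= t].
Proof.
move=> mGamma; rewrite (_ : [set w | _] =
    [set: T] `&` (fun w => supp_fun (Gamma w) u) @^-1` `]-oo, t]%classic).
  by apply: measurable_supp_fun => //; exact: measurable_itv.
by rewrite setTI set_itvNyc.
Qed.

(** Both infima in the depth have this shape, with [S] the sphere, [C u] the
    levels whose halfspace in direction [u] contains [K], and [s] the support
    function of [K]. *)
Lemma ereal_inf_optimal_param (R : realType) (U V : Type) (S : set U)
    (C : U -> set V) (f : U -> V -> \bar R) (s : U -> V) :
  (forall u, C u (s u)) ->
  (forall u t, S u -> C u t -> (f u (s u) <= f u t)%E) ->
  ereal_inf [set f ut.1 ut.2 | ut in [set ut : U * V | S ut.1 /\ C ut.1 ut.2]] =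
  ereal_inf [set f u (s u) | u in S].
Proof.
move=> Cs fmin; apply/le_anti/andP; split.
- by apply: ereal_inf_le_tmp => _ [u Su <-]; exists (u, s u).
- apply: le_ereal_inf_tmp => _ [[u t] /= [Su Ct] <-].
  by apply: ge_ereal_inf; exists (f u (s u)); [exists u|exact: fmin].
Qed.

Theorem mainTheorem1 (R : realType) (p : nat) (hp : (1 <= p)%N)
  (d : measure_display) (T : measurableType d) (P : probability T R)
  (Gamma : T -> Kc R p) (hGamma : random_set Gamma) (K : Kc R p) :
  tukey_depth P K Gamma =
  Order.min
    (ereal_inf [set P [set w | supp_fun (Gamma w) u <= supp_fun K u]
               | u in @sphere R p])
    (ereal_inf [set P [set w | supp_fun (Gamma w) u >= supp_fun K u]
               | u in @sphere R p]).
Proof.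
rewrite /tukey_depth; congr Order.min.
- apply: (@ereal_inf_optimal_param R _ _ (@sphere R p)
    (fun u t => Sminus u t K) (fun u t => P (Gamma @^-1` Sminus u t))
    (supp_fun K)) => [u|u t _ Kt]; first exact: lexx.
  apply: le_measure; rewrite ?inE; try exact: measurable_le_supp_fun.
  by move=> w /= /le_trans; apply.
- apply: (@ereal_inf_optimal_param R _ _ (@sphere R p)
    (fun u t => Splus u t K) (fun u t => P (Gamma @^-1` Splus u t))
    (supp_fun K)) => [u|u t _ Kt]; first exact: lexx.
  apply: le_measure; rewrite ?inE; try exact: measurable_ge_supp_fun.
  by move=> w /=; exact: le_trans.
Qed.
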